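(* Let $I=(0,r)$ be a bounded open interval and let $\{u^{\varepsilon_k}\}_{k=1}^\infty\subset W^{1,1}(I)$ be a sequence with $\sup_k\mathrm{TV}(u^{\varepsilon_k})<\infty$. Suppose that the unfoldings $U^{\varepsilon_k}$ converge uniformly to a function $V$ on a bounded interval $J$, the domain of definition of $V$, and that the inverses $x^{\varepsilon_k}$ of the arc-length parameters of $u^{\varepsilon_k}$ converge uniformly to a limit $\overline x$ on $J$. Then for every $x\in\overline I$, $$\left(\limsup_{k\to\infty}{}^{*}\,u^{\varepsilon_k}\right)(x)=\max\{V(s):\ s\in J,\ \overline x(s)=x\},$$ $$\left(\liminf_{k\to\infty}{}_{*}\,u^{\varepsilon_k}\right)(x)=\min\{V(s):\ s\in J,\ \overline x(s)=x\}.$$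
   Context: Functions in $W^{1,1}(I)$ are identified with their continuous representatives on $\overline I$; $\mathrm{TV}(u)=\int_I|u_x|\,dx$. Unfolding. For $u\in W^{1,1}(I)$ the arc-length parameter of its graph is $s_u(x)=\int_0^x(1+u_x(z)^2)^{1/2}dz$, $x\in\overline I$; $L_u=s_u(r)$ is the length of the graph; $x_u:[0,L_u]\to\overline I$ is the inverse function of $s_u$; and the unfolding of $u$ is $U(s)=u(x_u(s))$, $s\in[0,L_u]$. For $u=u^{\varepsilon_k}$ these are denoted $x^{\varepsilon_k}$, $U^{\varepsilon_k}$ and the length is denoted $L_k$. Uniform convergence on the domain $J$ of the limit is understood as follows: $L_k\to L$, $J=[0,L]$, and, after extending $U^{\varepsilon_k}$ and $x^{\varepsilon_k}$ beyond $L_k$ by their constant values at $L_k$, one has $U^{\varepsilon_k}\to V$ and $x^{\varepsilon_k}\to\overline x$ uniformly on $J$. Relaxed limits. For a sequence $g_k:\overline I\to\mathbf R$ and $x\in\overline I$, $$\left(\limsup_{k\to\infty}{}^{*}g_k\right)(x)=\lim_{j\to\infty}\sup\{g_k(y):\ y\in\overline I,\ |y-x|<1/j,\ k\ge j\},$$ $$\left(\liminf_{k\to\infty}{}_{*}g_k\right)(x)=\lim_{j\to\infty}\inf\{g_k(y):\ y\in\overline I,\ |y-x|<1/j,\ k\ge j\}.$$ *)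

(* Defs.v *)
From HB Require Import structures.
From mathcomp Require Import all_boot all_order all_algebra.
From mathcomp Require Import all_classical all_reals all_analysis.

Set Implicit Arguments.
Unset Strict Implicit.
Unset Printing Implicit Defensive.

Import Order.TTheory GRing.Theory Num.Theory.
Import numFieldNormedType.Exports.

Local Open Scope classical_set_scope.
Local Open Scope ring_scope.

(* The interval I is ]0, r[.  A function on the closure of I is represented by
   a total function R -> R whose values outside `[0, r] are irrelevant. *)

Definition test_function (R : realType) (r : R) (phi : R -> R) : Prop :=
  (forall (n : nat) (x : R), derivable (derive1n n phi) x 1) /\
  closure [set x | phi x != 0] `<=` `]0, r[.

Definition is_weak_derivative (R : realType) (r : R) (u g : R -> R) : Prop :=
  (@lebesgue_measure R).-integrable `]0, r[ (EFin \o g) /\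
  forall phi : R -> R, test_function r phi ->
    \int[@lebesgue_measure R]_(x in `]0, r[) (u x * derive1 phi x) =
    - \int[@lebesgue_measure R]_(x in `]0, r[) (g x * phi x).

(* u is the continuous representative, on the closed interval, of an element
   of W^{1,1}(I). *)
Definition W11 (R : realType) (r : R) (u : R -> R) : Prop :=
  [/\ {within `[0, r], continuous u},
      (@lebesgue_measure R).-integrable `]0, r[ (EFin \o u) &
      exists g : R -> R, is_weak_derivative r u g].

(* A representative of the a.e. class u_x; only integrals of it are used. *)
Definition weak_derivative (R : realType) (r : R) (u : R -> R) : R -> R :=
  xget (fun=> 0) [set g | is_weak_derivative r u g].

Definition TV (R : realType) (r : R) (u : R -> R) : \bar R :=
  (\int[@lebesgue_measure R]_(x in `]0%R, r[)
    (`|weak_derivative r u x|)%:E)%E.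

Definition arc_length_param (R : realType) (r : R) (u : R -> R) (x : R) : R :=
  \int[@lebesgue_measure R]_(z in `]0, x[)
    Num.sqrt (1 + weak_derivative r u z ^+ 2).

Definition graph_length (R : realType) (r : R) (u : R -> R) : R :=
  arc_length_param r u r.

Definition arc_length_inverse (R : realType) (r : R) (u : R -> R) : R -> R :=
  'pinv_(fun=> 0) `[0, r] (arc_length_param r u).

Definition unfolding (R : realType) (r : R) (u : R -> R) (s : R) : R :=
  u (arc_length_inverse r u s).

Definition extend_const (R : realType) (l : R) (f : R -> R) (s : R) : R :=
  f (Num.min s l).

(* Sequences are indexed from 0: the term of index k is the (k+1)-st one, so
   k.+1 >= j.+1 is j <= k and the radius 1/j becomes j.+1%:R^-1. *)
Definition relaxed_limsup (R : realType) (r : R) (g : nat -> R -> R) (x : R) :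
    \bar R :=
  limn (fun j : nat => ereal_sup [set z : \bar R | exists k y,
    [/\ (j <= k)%N, y \in `[0, r], `|y - x| < j.+1%:R^-1 & z = (g k y)%:E]]).

Definition relaxed_liminf (R : realType) (r : R) (g : nat -> R -> R) (x : R) :
    \bar R :=
  limn (fun j : nat => ereal_inf [set z : \bar R | exists k y,
    [/\ (j <= k)%N, y \in `[0, r], `|y - x| < j.+1%:R^-1 & z = (g k y)%:E]]).

Definition is_max (R : realType) (A : set R) (m : R) : Prop :=
  A m /\ ubound A m.

Definition is_min (R : realType) (A : set R) (m : R) : Prop :=
  A m /\ lbound A m.

(* Main.v *)
(* In the arc-length parameter s of the graph, both the horizontal coordinate
   x^k and the unfolding U^k are 1-Lipschitz; so are the limits xbar and V, and
   xbar maps [0, L] onto [0, r].  If u^k(y) is evaluated at y close to x, then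
   y = x^k(s) and u^k(y) = U^k(s) for some s; up to a small error s lies in
   [0, L], xbar(s) is close to x and u^k(y) is close to V(s).  Compactness of
   [0, L] then bounds u^k(y) by the maximum of V on the fibre of xbar over x,
   and the maximum is attained along y_k = x^k(s0) for a maximiser s0.  The
   minimum is obtained by applying this to -u^k.
   Points s between L and L_k > L are not seen by the uniform convergence; they
   are handled by the Lipschitz bound for U^k, which rests on
   |u(y) - u(x)| <= s_u(y) - s_u(x).  This is obtained by testing the weak
   derivative against smooth approximations of the indicator of [x, y]. *)
Require Import Defs.
From HB Require Import structures.
From mathcomp Require Import all_boot all_order all_algebra.
From mathcomp Require Import all_classical all_reals all_analysis.
From mathcomp Require Import measurable_realfun ring lra.
Set Implicit Arguments.
Unset Strict Implicit.
Unset Printing Implicit Defensive.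

Import Order.TTheory GRing.Theory Num.Theory.
Import numFieldNormedType.Exports.
Local Open Scope classical_set_scope.
Local Open Scope ring_scope.

(** * Smooth ramps *)

(** The recursion replaces [f] by its derivative, so the closure rules below go by induction on [n].
    Order [0] already asks for one derivative. *)
Fixpoint differentiable_upto (R : realType) (n : nat) (f : R -> R) : Prop :=
  (forall x : R, derivable f x 1) /\
  (if n is m.+1 then differentiable_upto m (derive1 f) else True).

Lemma derive1_eq (R : realType) (f g : R -> R) :
  (forall x : R, is_derive x 1 f (g x)) -> derive1 f = g.
Proof.
by move=> fg; apply/funext => x; rewrite derive1E; have [_ ->] := fg x.
Qed.

Lemma is_derive1 (R : realType) (f : R -> R) :
  (forall x : R, derivable f x 1) ->
  forall x : R, is_derive x 1 f (derive1 f x).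
Proof. by move=> df x; rewrite derive1E; exact: derivableP. Qed.

Lemma differentiable_upto0 (R : realType) (f g : R -> R) :
  (forall x : R, is_derive x 1 f (g x)) -> differentiable_upto 0 f.
Proof. by move=> fg; split=> [x|]; [have [] := fg x|exact: I]. Qed.

Lemma differentiable_uptoS (R : realType) n (f g : R -> R) :
  (forall x : R, is_derive x 1 f (g x)) -> differentiable_upto n g ->
  differentiable_upto n.+1 f.
Proof.
move=> fg ng; split=> [x|]; first by have [] := fg x.
by rewrite (derive1_eq fg).
Qed.

Lemma differentiable_upto_derivable (R : realType) n (f : R -> R) :
  differentiable_upto n f -> forall x : R, derivable f x 1.
Proof. by case: n => [|n] []. Qed.

Lemma differentiable_uptoW (R : realType) n (f : R -> R) :
  differentiable_upto n.+1 f -> differentiable_upto n f.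
Proof.
elim: n f => [|n IH] f [df nf]; split; [exact: df|exact: I|exact: df|].
exact: IH.
Qed.

Lemma derivable_derive1n (R : realType) (f : R -> R) :
  (forall n, differentiable_upto n f) ->
  forall n (x : R), derivable (derive1n n f) x 1.
Proof.
move=> + n; elim: n f => [|n IH] f fsm x; first by have [] := fsm 0%N.
by rewrite derive1Sn; apply: IH => m; have [] := fsm m.+1.
Qed.

Lemma differentiable_upto_cst (R : realType) n (c : R) :
  differentiable_upto n (fun=> c).
Proof.
elim: n c => [|n IH] c; last first.
  by apply: differentiable_uptoS (IH 0) => x; exact: is_derive_cst.
by apply: (@differentiable_upto0 _ _ (fun=> 0)) => x; exact: is_derive_cst.
Qed.

Lemma differentiable_uptoD (R : realType) n (f g : R -> R) :
  differentiable_upto n f -> differentiable_upto n g ->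
  differentiable_upto n (fun x => f x + g x).
Proof.
have dD (f1 f2 : R -> R) : (forall x : R, derivable f1 x 1) ->
    (forall x : R, derivable f2 x 1) ->
    forall x : R, is_derive x 1 (fun x => f1 x + f2 x)
      (derive1 f1 x + derive1 f2 x).
  by move=> d1 d2 x; apply: is_deriveD; exact: is_derive1.
elim: n f g => [|n IH] f g [df nf] [dg ng].
  exact: differentiable_upto0 (dD _ _ df dg).
exact: differentiable_uptoS (dD _ _ df dg) (IH _ _ nf ng).
Qed.

(** The product rule keeps one factor undifferentiated in each term, so [differentiable_uptoW]
    lowers its order before the induction hypothesis applies. *)
Lemma differentiable_uptoM (R : realType) n (f g : R -> R) :
  differentiable_upto n f -> differentiable_upto n g ->
  differentiable_upto n (fun x => f x * g x).
Proof.
have dM (f1 f2 : R -> R) : (forall x : R, derivable f1 x 1) ->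
    (forall x : R, derivable f2 x 1) ->
    forall x : R, is_derive x 1 (fun x => f1 x * f2 x)
      (f1 x * derive1 f2 x + f2 x * derive1 f1 x).
  by move=> d1 d2 x; apply: is_deriveM; exact: is_derive1.
elim: n f g => [|n IH] f g nf ng; have [df nf'] := nf; have [dg ng'] := ng.
  exact: differentiable_upto0 (dM _ _ df dg).
apply: differentiable_uptoS (dM _ _ df dg) _.
apply: differentiable_uptoD; apply: IH.
- exact: differentiable_uptoW.
- exact: ng'.
- exact: differentiable_uptoW.
- exact: nf'.
Qed.

(** The derivative is a product of [derive1 f] and two copies of the inverse itself, which the
    induction hypothesis covers one order lower. *)
Lemma differentiable_uptoV (R : realType) n (f : R -> R) :
  (forall x, f x != 0) -> differentiable_upto n f ->
  differentiable_upto n (fun x => (f x)^-1).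
Proof.
move=> f0 nf; have df := differentiable_upto_derivable nf.
have dV (x : R) : is_derive x 1 (fun x => (f x)^-1)
    ((-1 * derive1 f x) * ((f x)^-1 * (f x)^-1)).
  have -> : -1 * derive1 f x * ((f x)^-1 * (f x)^-1) =
      - (f x) ^- 2 *: derive1 f x.
    by rewrite /GRing.scale/= expr2 invfM; ring.
  by apply: is_deriveV; [exact: f0|exact: is_derive1].
elim: n nf => [|n IH] nf; first exact: differentiable_upto0 dV.
have [_ nf'] := nf; have nV := IH (differentiable_uptoW nf).
apply: differentiable_uptoS dV _.
apply: differentiable_uptoM; last exact: differentiable_uptoM.
by apply: differentiable_uptoM nf'; exact: differentiable_upto_cst.
Qed.

Lemma is_derive_affine (R : realType) (f : R -> R) (a b : R) :
  (forall x : R, derivable f x 1) -> forall x : R,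
  is_derive x 1 (fun x => f (a * x + b)) (a * derive1 f (a * x + b)).
Proof.
move=> df x; rewrite mulrC.
apply: (@is_derive1_comp _ f (fun x => a * x + b)); first exact: is_derive1.
apply: is_derive_eq.
by rewrite addr0 /GRing.scale/= mulr1.
Qed.

Lemma differentiable_upto_affine (R : realType) n (f : R -> R) (a b : R) :
  differentiable_upto n f -> differentiable_upto n (fun x => f (a * x + b)).
Proof.
elim: n f => [|n IH] f [df nf].
  exact: differentiable_upto0 (is_derive_affine a b df).
apply: differentiable_uptoS (is_derive_affine a b df) _.
by apply: differentiable_uptoM; [exact: differentiable_upto_cst|exact: IH].
Qed.

Section smooth_step.
Variable R : realType.
(* The derivative of [expinv m] is a linear combination of [expinv m.+1] and
   [expinv m.+2], so smoothness follows by induction for all [m] at once. *)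
Definition expinv (m : nat) (x : R) : R :=
  if 0 < x then x^-1 ^+ m * expR (- x^-1) else 0.
Lemma expinv_ge0 m x : 0 <= expinv m x.
Proof.
rewrite /expinv; case: ltP => // x0.
by rewrite mulr_ge0 ?expR_ge0// exprn_ge0// invr_ge0 ltW.
Qed.

(** For [x > 0] and [t = 1/x], the exponential series gives [e^t >= t^(m+1)/(m+1)!], hence
    [t^m e^(-t) <= (m+1)!/t]. *)
Lemma expinv_le m x : expinv m x <= m.+1`!%:R * `|x|.
Proof.
rewrite /expinv; case: ltP => x0; last by rewrite mulr_ge0.
have t0 : 0 < x^-1 by rewrite invr_gt0.
rewrite (gtr0_norm x0) -[X in _ <= _ * X]invrK.
set t := x^-1 in t0 *.
have := expR_ge1Dxn m (ltW t0).
rewrite expRN ler_pdivrMr ?expR_gt0// => Et.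
rewrite -mulrA mulrCA ler_pdivlMl// -exprS mulrC -ler_pdivrMr ?ltr0n ?fact_gt0//.
by apply: le_trans Et; rewrite lerDr.
Qed.

Lemma is_derive_expinv m (x : R) :
  is_derive x 1 (expinv m) (- m%:R * expinv m.+1 x + expinv m.+2 x).
Proof.
have [x0|x0|<-] := ltgtP 0 x.
- apply: (@near_eq_is_derive R R R (fun y : R => y^-1 ^+ m * expR (- y^-1)) _ x 1).
    near=> y; rewrite /expinv ifT//; near: y; exact: lt_nbhsr.
  have xn0 : x != 0 by rewrite gt_eqF.
  have dV : is_derive x 1 (fun y : R => y^-1) (- x ^- 2 *: 1).
    exact: (@is_deriveV _ id).
  have d1 := is_deriveX m dV.
  rewrite exprfctE in d1.
  have d2 : is_derive x 1 (fun y : R => expR (- y^-1)) (expR (- x^-1) * (x ^- 2)).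
    apply: (@is_derive1_comp _ expR (fun y => - y^-1)).
    apply: is_derive_eq.
    by rewrite /GRing.scale/= mulr1 opprK.
  apply: (is_derive_eq (is_deriveM d1 d2)).
  rewrite /expinv x0 /GRing.scale/=.
  case: m d1 => [|m] d1; rewrite /= -?exprVn !exprS; ring.
- apply: (@near_eq_is_derive R R R (fun=> 0) _ x 1).
    near=> y; rewrite /expinv ifF//; apply/negbTE; rewrite -leNgt ltW//.
    near: y; exact: lt_nbhsl.
  rewrite /expinv !ifF ?mulr0 ?addr0; last 2 first.
  - by apply/negbTE; rewrite -leNgt ltW.
  - by apply/negbTE; rewrite -leNgt ltW.
  exact: is_derive_cst.
- rewrite {2 3}/expinv ltxx mulr0 addr0.
  (* The difference quotient at the origin is [expinv m.+1 h] for [h > 0] and 0 otherwise, so the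
     linear bound [expinv_le] makes it vanish in the limit. *)
  have c0 : (fun h : R => h^-1 *: ((expinv m \o shift 0) (h *: 1) - expinv m 0))
      @ 0^' --> 0.
    apply/cvgrPdist_le => e e0.
    near=> h; rewrite sub0r normrN /= addr0 /GRing.scale/= mulr1.
    rewrite {2}/expinv ltxx subr0.
    have [h0|h0] := ltP 0 h; last first.
      by rewrite /expinv ltNge h0/= mulr0 normr0 ltW.
    have -> : h^-1 * expinv m h = expinv m.+1 h.
      by rewrite /expinv h0 mulrA exprS.
    rewrite ger0_norm ?expinv_ge0//; apply: (le_trans (expinv_le _ _)).
    rewrite -ler_pdivlMl; last by rewrite ltr0n fact_gt0.
    near: h. apply: dnbhs0_le. 
    by rewrite mulr_gt0// invr_gt0 ltr0n fact_gt0.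
  apply: DeriveDef; first by apply/cvg_ex; exists 0.
  exact: cvg_lim c0.
Unshelve. all: by end_near.
Qed.

Lemma differentiable_upto_expinv n m : differentiable_upto n (expinv m).
Proof.
elim: n m => [|n IH] m; first exact: differentiable_upto0 (is_derive_expinv m).
apply: differentiable_uptoS (is_derive_expinv m) _.
apply: differentiable_uptoD (IH _).
by apply: differentiable_uptoM (IH _); exact: differentiable_upto_cst.
Qed.

(** The standard smooth transition from 0 on [x <= 0] to 1 on [1 <= x]. *)
Definition smooth_step (x : R) : R :=
  expinv 0 x / (expinv 0 x + expinv 0 (1 - x)).

Lemma expinv0_gt0 x : 0 < x -> 0 < expinv 0 x.
Proof. by move=> x0; rewrite /expinv x0 expr0 mul1r expR_gt0. Qed.

Lemma expinv0_eq0 x : x <= 0 -> expinv 0 x = 0.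
Proof. by move=> x0; rewrite /expinv ltNge x0. Qed.

(** [x] and [1 - x] are never both nonpositive. *)
Let den_gt0 x : 0 < expinv 0 x + expinv 0 (1 - x).
Proof.
have [x0|x0] := ltP 0 x; last by rewrite ltr_wpDl ?expinv_ge0 ?expinv0_gt0//; lra.
by rewrite ltr_pwDl ?expinv_ge0 ?expinv0_gt0.
Qed.

Lemma differentiable_upto_smooth_step n : differentiable_upto n smooth_step.
Proof.
apply: differentiable_uptoM; first exact: differentiable_upto_expinv.
apply: differentiable_uptoV; first by move=> x; rewrite gt_eqF.
apply: differentiable_uptoD; first exact: differentiable_upto_expinv.
have -> : (fun x => expinv 0 (1 - x)) = (fun x => expinv 0 (-1 * x + 1)).
  by apply/funext => x; congr expinv; ring.
by apply: differentiable_upto_affine; exact: differentiable_upto_expinv.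
Qed.

Lemma smooth_step_ge0 x : 0 <= smooth_step x.
Proof. by rewrite divr_ge0 ?expinv_ge0// ltW. Qed.

Lemma smooth_step_le1 x : smooth_step x <= 1.
Proof. by rewrite ler_pdivrMr// mul1r lerDl expinv_ge0. Qed.

Lemma smooth_step_eq0 x : x <= 0 -> smooth_step x = 0.
Proof. by move=> x0; rewrite /smooth_step expinv0_eq0// mul0r. Qed.

Lemma smooth_step_eq1 x : 1 <= x -> smooth_step x = 1.
Proof.
move=> x1; rewrite /smooth_step [X in _ + X]expinv0_eq0; last by lra.
rewrite addr0 divff// gt_eqF// expinv0_gt0//; lra.
Qed.

Lemma expinv0_le x y : x <= y -> expinv 0 x <= expinv 0 y.
Proof.
move=> xy; have [x0|x0] := ltP 0 x; last by rewrite expinv0_eq0// expinv_ge0.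
have y0 := lt_le_trans x0 xy.
by rewrite /expinv x0 y0 !expr0 !mul1r ler_expR lerN2 lef_pV2.
Qed.

(** With [p(x) = expinv 0 x] and [q(x) = expinv 0 (1 - x)], cross-multiplying and cancelling
    [p(x) p(y)] leaves [p(x) q(y) <= p(y) q(x)], where [p] is nondecreasing and [q]
    nonincreasing. *)
Lemma smooth_step_le x y : x <= y -> smooth_step x <= smooth_step y.
Proof.
move=> xy; rewrite /smooth_step ler_pdivrMr// mulrAC ler_pdivlMr//.
rewrite !mulrDr [X in X + _ <= _]mulrC lerD2l ler_pM ?expinv_ge0 ?expinv0_le//.
by lra.
Qed.
End smooth_step.

(** [incr_derive1_ge0] is applied to a strictly increasing function, obtained by adding [e * y];
    then [e] is arbitrary. *)
Lemma nondecreasing_derive1_ge0 (R : realType) (f : R -> R) (x : R) :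
  (forall x : R, derivable f x 1) -> {homo f : a b / a <= b} ->
  0 <= derive1 f x.
Proof.
move=> df ndf; apply/ler_addgt0Pr => e e0.
have dg (z : R) : is_derive z 1 (fun y => f y + e * y) (derive1 f z + e).
  apply: is_deriveD; first exact: is_derive1.
  apply: is_derive_eq.
  by rewrite /GRing.scale/= mulr1.
rewrite -[_ + e]/((fun z => derive1 f z + e) x) -(derive1_eq dg).
apply: (@incr_derive1_ge0 _ _ setT).
- by move=> z _; have [] := dg z.
- move=> a b _ _ ab; rewrite ler_ltD//; first by rewrite ndf// ltW.
  by rewrite ltr_pM2l.
- by rewrite interiorT.
Qed.

(** * Arc length and the weak derivative *)

Lemma integrable_cst_itv (R : realType) (a b c : R) (b0 b1 : bool) :
  (@lebesgue_measure R).-integrable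
    [set` Interval (BSide b0 a) (BSide b1 b)] (EFin \o cst c).
Proof.
have ic : (@lebesgue_measure R).-integrable `[a, b] (EFin \o cst c).
  apply: continuous_compact_integrable; first exact: segment_compact.
  by apply: continuous_subspaceT => x; exact: cvg_cst.
apply: integrableS ic => //.
by apply: subset_itvScc; rewrite bnd_simp; case: b0; case: b1.
Qed.

Section arc_length.
Variables (R : realType) (r : R) (g : R -> R).
Local Notation mu := (@lebesgue_measure R).
Local Notation w := (fun z => Num.sqrt (1 + g z ^+ 2)).
Hypothesis r0 : 0 < r.
Hypothesis ig : mu.-integrable `]0, r[ (EFin \o g).

Lemma ler_norm_sqrt1Dsqr (z : R) : `|g z| <= w z.
Proof. by rewrite -sqrtr_sqr ler_sqrt ?lerDr// addr_ge0// sqr_ge0. Qed.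

Lemma sqrt1Dsqr_ge1 (z : R) : 1 <= w z.
Proof. by rewrite -[leLHS]sqrtr1 ler_sqrt ?lerDl ?sqr_ge0// addr_ge0// sqr_ge0. Qed.

(** The integrand is dominated by [1 + |g|]. The endpoints are null, and the closed interval is the
    form that [parameterized_integral] works with. *)
Lemma integrable_sqrt1Dsqr : mu.-integrable `[0, r] (EFin \o w).
Proof.
have mg : measurable_fun `]0, r[ g.
  by apply/measurable_EFinP; exact: (measurable_int mu).
have mw : measurable_fun `]0, r[ w.
  rewrite -[w]/(Num.sqrt \o (fun z => 1 + g z ^+ 2)).
  apply: measurableT_comp; first exact: continuous_measurable_fun (@sqrt_continuous R).
  by apply: measurable_funD => //; exact: measurable_funX.
have iw : mu.-integrable `]0, r[ (EFin \o w).
  apply: (@le_integrable _ _ R mu _ _ (EFin \o w) (EFin \o (fun z => 1 + `|g z|))).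
  - by [].
  - exact/measurable_EFinP.
  - move=> z _; rewrite /= lee_fin ger0_norm ?sqrtr_ge0//.
    rewrite ger0_norm ?addr_ge0// -[leRHS]ger0_norm ?addr_ge0// -sqrtr_sqr.
    rewrite ler_sqrt ?sqr_ge0//.
    by rewrite sqrrD expr1n real_normK ?num_real// mul1r lerD2r lerDl mulrn_wge0.
  - have -> : EFin \o (fun z => 1 + `|g z|) =
        ((EFin \o cst 1%R) \+ (EFin \o (fun z => `|g z|%R)))%E by [].
    apply: integrableD => //; last exact: integrable_norm.
    exact: integrable_cst_itv.
have mw' : measurable_fun `[0, r] w by apply: measurable_fun_itv_cc mw.
apply/integrableP; split; first exact/measurable_EFinP.
rewrite integral_itv_bndoo; last first.
  by apply: measurableT_comp => //; exact/measurable_EFinP.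
by have /integrableP[] := iw.
Qed.

Lemma Rintegral_sqrt1Dsqr (x : R) : x \in `[0, r] ->
  \int[mu]_(z in `]0, x[) w z = parameterized_integral mu 0 x w.
Proof.
rewrite in_itv/= => /andP[x0 xr].
have iw : mu.-integrable `]0, x[ (EFin \o w).
  apply: integrableS integrable_sqrt1Dsqr => //.
  by move=> z /=; rewrite !in_itv/= => ?; lra.
rewrite /parameterized_integral /Rintegral [in RHS]integral_itv_bndoo//.
exact: (measurable_int mu).
Qed.

Lemma arc_length_increment (x y : R) : 0 <= x -> x <= y -> y <= r ->
  \int[mu]_(z in `]0, y[) w z - \int[mu]_(z in `]0, x[) w z =
  \int[mu]_(z in `]x, y]) w z.
Proof.
move=> x0 xy yr.
rewrite !Rintegral_sqrt1Dsqr ?in_itv/= ?x0 ?yr ?(le_trans x0) ?(le_trans xy)//.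
rewrite /parameterized_integral Rintegral_itvB ?bnd_simp//.
apply: integrableS integrable_sqrt1Dsqr => //.
by move=> z /=; rewrite !in_itv/= => ?; lra.
Qed.

(** The integrand is at least 1. This is what makes arc length injective and its inverse
    1-Lipschitz. *)
Lemma arc_length_increment_ge (x y : R) : 0 <= x -> x <= y -> y <= r ->
  y - x <= \int[mu]_(z in `]0, y[) w z - \int[mu]_(z in `]0, x[) w z.
Proof.
move=> x0 xy yr; rewrite arc_length_increment//.
have -> : y - x = \int[mu]_(z in `]x, y]) 1.
  rewrite Rintegral_cst//= mul1r lebesgue_measure_itv/= lte_fin.
  by case: ltgtP xy => //= -> _; rewrite subrr.
apply: le_Rintegral => //.
- exact: integrable_cst_itv.
- apply: integrableS integrable_sqrt1Dsqr => //.
  by move=> z /=; rewrite !in_itv/= => ?; lra.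
- by move=> z _; exact: sqrt1Dsqr_ge1.
Qed.

Lemma arc_length_continuous :
  {within `[0, r], continuous (fun x => \int[mu]_(z in `]0, x[) w z)}.
Proof.
have cS := parameterized_integral_continuous (ltW r0) integrable_sqrt1Dsqr.
apply: (subspace_eq_continuous _ cS) => x; rewrite inE => xr.
by rewrite /from_subspace Rintegral_sqrt1Dsqr.
Qed.

(** Only []a, b]] contributes to the integral, and there [|g phi| <= |g| <= sqrt(1 + g^2)]. *)
Lemma Rintegral_supported_le (phi : R -> R) (a b : R) :
  0 < a -> a <= b -> b < r -> measurable_fun setT phi ->
  (forall z, `|phi z| <= 1) ->
  (forall z, z <= a -> phi z = 0) -> (forall z, b <= z -> phi z = 0) ->
  `|\int[mu]_(z in `]0, r[) (g z * phi z)| <=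
  \int[mu]_(z in `]0, b[) w z - \int[mu]_(z in `]0, a[) w z.
Proof.
move=> a0 ab br mphi phi1 phia phib.
rewrite arc_length_increment//; [|exact: ltW..].
have igphi : mu.-integrable `]0, r[ (EFin \o (fun z => g z * phi z)).
  apply: (@le_integrable _ _ R mu _ _
    (EFin \o (fun z => g z * phi z)) (EFin \o g)) => //.
    apply/measurable_EFinP; apply: measurable_funM.
      by apply/measurable_EFinP; exact: (measurable_int mu).
    exact: measurable_funS mphi.
  move=> z _; rewrite /= lee_fin normrM ler_piMr//.
have sub : [set` `]a, b]] `<=` [set` `]0, r[].
  by move=> z /=; rewrite !in_itv/= => ?; lra.
have -> : \int[mu]_(z in `]0, r[) (g z * phi z) =
    \int[mu]_(z in `]a, b]) (g z * phi z).
  rewrite -[in RHS](setIidr sub) Rintegral_mkcondr; apply: eq_Rintegral => z _.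
  rewrite patchE; case: ifPn => //; rewrite notin_setE/= in_itv/= => /negP.
  by rewrite negb_and -leNgt -ltNge => /orP[/phia|/ltW/phib] ->; rewrite mulr0.
have igphi' : mu.-integrable `]a, b] (EFin \o (fun z => g z * phi z)).
  exact: integrableS igphi.
apply: (le_trans (le_normr_Rintegral _ igphi')) => //.
apply: le_Rintegral => //.
- exact: integrable_norm.
- apply: integrableS integrable_sqrt1Dsqr => //.
  by move=> z /=; rewrite !in_itv/= => ?; lra.
- move=> z _; rewrite normrM (le_trans _ (ler_norm_sqrt1Dsqr z))//.
  by rewrite ler_piMr.
Qed.
End arc_length.

(** * Ramps at a given place and width; their derivatives as approximate point masses *)

Section ramp.
Variables (R : realType) (a h : R).
Hypothesis h0 : 0 < h.

(** The argument is [(x - a) / h], in the affine shape of [differentiable_upto_affine]; the ramp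
    rises from 0 at [a] to 1 at [a + h]. *)
Definition ramp (x : R) : R := smooth_step (h^-1 * x + - (h^-1 * a)).

Let argE x : h^-1 * x + - (h^-1 * a) = (x - a) / h.
Proof. by rewrite -mulrBr mulrC. Qed.

Lemma differentiable_upto_ramp n : differentiable_upto n ramp.
Proof.
by apply: differentiable_upto_affine; exact: differentiable_upto_smooth_step.
Qed.

Lemma derivable_ramp (x : R) : derivable ramp x 1.
Proof. exact: differentiable_upto_derivable (differentiable_upto_ramp 0) x. Qed.

Lemma continuous_ramp : continuous ramp.
Proof.
by move=> x; apply/differentiable_continuous/derivable1_diffP/derivable_ramp.
Qed.

Lemma continuous_derive1_ramp : continuous (derive1 ramp).
Proof.
move=> x; apply/differentiable_continuous/derivable1_diffP.
by have [_ []] := differentiable_upto_ramp 1.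
Qed.

Lemma ramp_ge0 x : 0 <= ramp x. Proof. exact: smooth_step_ge0. Qed.

Lemma ramp_le1 x : ramp x <= 1. Proof. exact: smooth_step_le1. Qed.

Lemma ramp_eq0 x : x <= a -> ramp x = 0.
Proof.
move=> xa; apply: smooth_step_eq0.
by rewrite argE pmulr_lle0 ?invr_gt0// subr_le0.
Qed.

Lemma ramp_eq1 x : a + h <= x -> ramp x = 1.
Proof.
move=> xa; apply: smooth_step_eq1.
by rewrite argE ler_pdivlMr// mul1r; lra.
Qed.

Lemma ramp_derive1_ge0 x : 0 <= derive1 ramp x.
Proof.
apply: nondecreasing_derive1_ge0; first exact: derivable_ramp.
move=> y z yz; apply: smooth_step_le.
by rewrite lerD2r ler_pM2l ?invr_gt0.
Qed.

Lemma ramp_derive1_eq0 x : x \notin `[a, a + h] -> derive1 ramp x = 0.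
Proof.
rewrite in_itv/= negb_and -!ltNge => /orP xah; rewrite derive1E.
have near_cst (c : R) : (\near x, c = ramp x) -> 'D_1 ramp x = 0.
  move=> cr; rewrite -(@near_eq_derive R R R (fun=> c) ramp x 1 cr).
  by rewrite derive_cst.
case: xah => xah.
  apply: (near_cst 0); near=> y; rewrite ramp_eq0// ltW//.
  by near: y; exact: lt_nbhsl.
apply: (near_cst 1); near=> y; rewrite ramp_eq1// ltW//.
by near: y; exact: lt_nbhsr.
Unshelve. all: by end_near.
Qed.
End ramp.

Lemma ramp_le_left (R : realType) (a b h x : R) :
  0 < h -> a <= b -> ramp b h x <= ramp a h x.
Proof.
move=> h0 ab; apply: smooth_step_le.
by rewrite lerD2l lerN2 ler_pM2l ?invr_gt0.
Qed.

Section ramp_density.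
Variables (R : realType) (r : R) (u : R -> R).
Local Notation mu := (@lebesgue_measure R).
Hypothesis r0 : 0 < r.
Hypothesis cu : {within `[0, r], continuous u}.

Lemma integrable_continuous_itvoo (f : R -> R) :
  {within `[0, r], continuous f} -> mu.-integrable `]0, r[ (EFin \o f).
Proof.
move=> cf; have cif : mu.-integrable `[0, r] (EFin \o f).
  by apply: continuous_compact_integrable => //; exact: segment_compact.
by apply: integrableS cif => //; apply: subset_itvScc; rewrite bnd_simp.
Qed.

Lemma within_continuous_mul_ramp (a h : R) :
  {within `[0, r], continuous (fun x => u x * derive1 (ramp a h) x)}.
Proof.
have cr : {within `[0, r], continuous (derive1 (ramp a h))}.
  by apply: continuous_subspaceT; exact: continuous_derive1_ramp.
by move=> x; apply: cvgM; [exact: cu|exact: cr].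
Qed.

(** By the fundamental theorem of calculus: the whole rise takes place inside [[0, r]]. *)
Lemma Rintegral_derive1_ramp (a h : R) : 0 < h -> 0 <= a -> a + h <= r ->
  \int[mu]_(x in `]0, r[) derive1 (ramp a h) x = 1.
Proof.
move=> h0 a0 ahr.
have cr : continuous (derive1 (ramp a h)) by exact: continuous_derive1_ramp.
have cr' : continuous (ramp a h) by exact: continuous_ramp.
have -> : \int[mu]_(x in `]0, r[) derive1 (ramp a h) x =
    fine (\int[mu]_(x in `[0%R, r]) (derive1 (ramp a h) x)%:E)%E.
  rewrite /Rintegral [in RHS]integral_itv_bndoo//.
  apply/measurable_EFinP; apply: measurable_funS (continuous_measurable_fun cr) => //.
rewrite (@continuous_FTC2 _ _ (ramp a h))//.
- by rewrite ramp_eq1// ramp_eq0// sube0.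
- by apply: continuous_subspaceT.
- split.
  + by move=> x _; exact: derivable_ramp.
  + exact/cvg_at_right_filter/cr'.
  + exact/cvg_at_left_filter/cr'.
Qed.

(** The derivative of the ramp is a probability density carried by [[a, a + h]], so the integral is
    an average of [u] over that interval. *)
Lemma Rintegral_mul_ramp_le (a h c e : R) : 0 < h -> 0 <= a -> a + h <= r ->
  (forall x, x \in `[a, a + h] -> `|u x - c| <= e) ->
  `|\int[mu]_(x in `]0, r[) (u x * derive1 (ramp a h) x) - c| <= e.
Proof.
move=> h0 a0 ahr uc.
set p := derive1 (ramp a h).
have ip : mu.-integrable `]0, r[ (EFin \o p).
  apply: integrable_continuous_itvoo.
  by apply: continuous_subspaceT; exact: continuous_derive1_ramp.
have iup : mu.-integrable `]0, r[ (EFin \o (fun x => u x * p x)).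
  exact/integrable_continuous_itvoo/within_continuous_mul_ramp.
have iZ (k : R) : mu.-integrable `]0, r[ (EFin \o (fun x => k * p x)).
  by rewrite (_ : _ \o _ = (fun x => k%:E * (EFin \o p) x)%E)//; exact: integrableZl.
have intp : \int[mu]_(x in `]0, r[) p x = 1 by exact: Rintegral_derive1_ramp.
rewrite -[X in _ - X]mulr1 -[X in _ - _ * X]intp -RintegralZl//.
rewrite -RintegralB//.
have iB : mu.-integrable `]0, r[ (EFin \o (fun x => u x * p x - c * p x)).
  rewrite (_ : _ \o _ = ((EFin \o (fun x => (u x * p x)%R)) \-
    (EFin \o (fun x => (c * p x)%R)))%E)//.
  exact: integrableB.
apply: (le_trans (le_normr_Rintegral _ iB)) => //.
rewrite -[leRHS]mulr1 -intp -RintegralZl//.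
apply: le_Rintegral => //; first exact: integrable_norm.
move=> x _; rewrite -mulrBl normrM [`|p x|]ger0_norm ?ramp_derive1_ge0//.
have [/uc ux|xah] := boolP (x \in `[a, a + h]).
  by rewrite ler_wpM2r// ramp_derive1_ge0.
by rewrite /p ramp_derive1_eq0// !mulr0.
Qed.
End ramp_density.

Lemma within_continuous_dist_le (R : realType) (A : set R) (u : R -> R) :
  {within A, continuous u} -> forall x e : R, A x -> 0 < e ->
  exists2 d : R, 0 < d & forall z, A z -> `|x - z| < d -> `|u x - u z| <= e.
Proof.
move=> /subspace_continuousP cu x e Ax e0.
have /cvgrPdist_le/(_ e e0) := cu x Ax.
by move=> /nbhs_ballP[d d0 dx]; exists d => // z Az xz; apply: (dx z xz Az).
Qed.

(** The two ramps cancel outside [[a, b + h]], a closed set inside []0, r[]. *)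
Lemma test_function_ramp (R : realType) (r a b h : R) :
  0 < h -> 0 < a -> a <= b -> b + h < r ->
  test_function r (fun x => ramp a h x + -1 * ramp b h x).
Proof.
move=> h0 a0 ab bhr; split.
  apply: derivable_derive1n => n; apply: differentiable_uptoD.
    exact: differentiable_upto_ramp.
  apply: differentiable_uptoM; first exact: differentiable_upto_cst.
  exact: differentiable_upto_ramp.
have sub : [set x | ramp a h x + -1 * ramp b h x != 0] `<=` [set` `[a, b + h]].
  move=> x /=; apply: contraR; rewrite in_itv/= negb_and -!ltNge => /orP[xa|xb].
    by rewrite !ramp_eq0 ?mulr0 ?addr0// ltW// (lt_le_trans xa).
  rewrite !ramp_eq1 ?mulr1 ?subrr// ltW//.
  by rewrite (le_lt_trans _ xb)// lerD2r.
move=> x /(closureS sub); rewrite -(iffLR (closure_id _)); last exact: itv_closed.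
by rewrite /= !in_itv/= => ?; lra.
Qed.

(* Testing the weak derivative against a smoothed indicator of [a, b] recovers
   the increment of the continuous representative u between a and b. *)
Lemma W11_increment_le (R : realType) (r : R) (u g : R -> R) (x y : R) :
  {within `[0, r], continuous u} -> is_weak_derivative r u g ->
  0 <= x -> x <= y -> y <= r ->
  `|u y - u x| <=
  \int[@lebesgue_measure R]_(z in `]0, y[) Num.sqrt (1 + g z ^+ 2) -
  \int[@lebesgue_measure R]_(z in `]0, x[) Num.sqrt (1 + g z ^+ 2).
Proof.
move=> cu [ig wg] x0 xy yr.
pose I (f : R -> R) : R := \int[@lebesgue_measure R]_(z in `]0, r[) f z.
pose S (t : R) : R :=
  \int[@lebesgue_measure R]_(z in `]0, t[) Num.sqrt (1 + g z ^+ 2).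
rewrite -/(S x) -/(S y).
have [->|xNy] := eqVneq x y; first by rewrite !subrr normr0.
have xy' : x < y by rewrite lt_neqAle xNy.
have r0 : 0 < r by lra.
apply/ler_addgt0Pr => e e0; have e20 : 0 < e / 2 by lra.
have xr : [set` `[0, r]] x by rewrite /= in_itv/= x0 (le_trans xy).
have yr' : [set` `[0, r]] y by rewrite /= in_itv/= yr (le_trans x0).
have [d1 d10 ux] := within_continuous_dist_le cu xr e20.
have [d2 d20 uy] := within_continuous_dist_le cu yr' e20.
(* The quarter leaves room for both layers: [[a, a + h] = [x + h, x + 2h]] stays within [d1] of [x],
   [[b, b + h] = [y - 2h, y - h]] within [d2] of [y], and [a <= b]. *)
pose h := Num.min (Num.min d1 d2) (y - x) / 4.
have [h0 hd1 hd2 hyx] : [/\ 0 < h, 4 * h <= d1, 4 * h <= d2 & 4 * h <= y - x].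
  rewrite /h; split.
  - by rewrite divr_gt0// !lt_min d10 d20 subr_gt0.
  - by rewrite mulrCA divff// mulr1 !ge_min lexx.
  - by rewrite mulrCA divff// mulr1 !ge_min lexx orbT.
  - by rewrite mulrCA divff// mulr1 !ge_min lexx !orbT.
pose a := x + h; pose b := y - 2 * h.
have a0 : 0 < a by rewrite /a; lra.
have ab : a <= b by rewrite /a/b; lra.
have bhr : b + h < r by rewrite /b; lra.
pose phi (z : R) : R := ramp a h z + -1 * ramp b h z.
pose A := I (fun z => u z * derive1 (ramp a h) z).
pose B := I (fun z => u z * derive1 (ramp b h) z).
pose G := I (fun z => g z * phi z).
have wphi : I (fun z => u z * derive1 phi z) = - G :=
  wg phi (test_function_ramp h0 a0 ab bhr).
have dphi (z : R) : is_derive z 1 phi (derive1 (ramp a h) z - derive1 (ramp b h) z).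
  have da := is_derive1 (derivable_ramp (a := a) (h := h)) z.
  have db := is_derive1 (derivable_ramp (a := b) (h := h)) z.
  apply: (is_derive_eq (is_deriveD da (is_deriveM (is_derive_cst (-1 : R) z 1) db))).
  by rewrite scaler0 addr0 /GRing.scale/= mulN1r.
have phi1 z : `|phi z| <= 1.
  have := ramp_ge0 b h z; have := ramp_le1 a h z; have := ramp_le_left z h0 ab.
  rewrite /phi ler_norml => ? ? ?; apply/andP; split; lra.
have mphi : measurable_fun setT phi.
  apply: continuous_measurable_fun => z.
  apply: cvgD; first exact: continuous_ramp.
  by apply: cvgM; [exact: cvg_cst|exact: continuous_ramp].
have phia z : z <= a -> phi z = 0.
  by move=> za; rewrite /phi !ramp_eq0// ?mulr0 ?addr0// (le_trans za).
have phib z : b + h <= z -> phi z = 0.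
  move=> zb; rewrite /phi !ramp_eq1 ?mulr1 ?subrr//.
  by rewrite (le_trans _ zb)// lerD2r.
have abh : a <= b + h by lra.
have intphi : `|G| <= S (b + h) - S a :=
  Rintegral_supported_le ig a0 abh bhr mphi phi1 phia phib.
have inta : `|A - u x| <= e / 2.
  apply: Rintegral_mul_ramp_le => //; [exact: ltW|rewrite /a; lra|].
  move=> z; rewrite in_itv/= => /andP[az zah]; rewrite distrC ux//=.
    by rewrite in_itv/=; rewrite /a in az zah; lra.
  by rewrite ltr_norml; rewrite /a in az zah; apply/andP; split; lra.
have intb : `|B - u y| <= e / 2.
  apply: Rintegral_mul_ramp_le => //; [rewrite /b; lra|rewrite /b; lra|].
  move=> z; rewrite in_itv/= => /andP[az zah]; rewrite distrC uy//=.
    by rewrite in_itv/=; rewrite /b in az zah; lra.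
  by rewrite ltr_norml; rewrite /b in az zah; apply/andP; split; lra.
have Sa : x <= a by rewrite /a; lra.
have Sb : b + h <= y by rewrite /b; lra.
have ira := integrable_continuous_itvoo
  (within_continuous_mul_ramp (r := r) (a := a) (h := h) cu).
have irb := integrable_continuous_itvoo
  (within_continuous_mul_ramp (r := r) (a := b) (h := h) cu).
have intphi' : I (fun z => u z * derive1 phi z) =
    A - B.
  rewrite -(RintegralB _ ira irb)//; apply: eq_Rintegral => z _.
  by rewrite (derive1_eq dphi) mulrBr.
(* Arc length does not decrease on [[x, a]] and [[b + h, y]], so the bound over [[a, b + h]] extends
   to [[x, y]]. *)
have : a - x <= S a - S x.
  exact (arc_length_increment_ge ig x0 Sa (le_trans abh (ltW bhr))).
have : y - (b + h) <= S y - S (b + h).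
  exact (arc_length_increment_ge ig (ltW (lt_le_trans a0 abh)) Sb yr).
(* Only linear arithmetic remains: [u y - u x] is within [e] of [B - A = G], which [intphi]
   bounds. *)
move: Sa Sb wphi intphi inta intb; rewrite intphi'.
clearbody A B G S a b; move: (b + h) (u x) (u y); clear.
move=> bh ux uy; rewrite !ler_norml.
move=> Sa1 Sb1 ABG /andP[G1 G2] /andP[A1 A2] /andP[B1 B2] S1 S2.
apply/andP; split; lra.
Qed.

(** * Relaxed limits of parametrized graphs *)

Lemma cvg_uniform_dist_le (R : realType) (A : set R) (F : nat -> R -> R)
    (f : R -> R) : {uniform A, F @ \oo --> f} ->
  forall e : R, 0 < e ->
  exists N, forall k, (N <= k)%N -> forall s, A s -> `|F k s - f s| <= e.
Proof.
move=> Ff e e0.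
have nf : nbhs (f : {uniform` A -> R}) [set h | forall s, A s -> `|h s - f s| <= e].
  apply/uniform_nbhs; exists [set xy | ball xy.1 e xy.2]; split.
    exact: entourage_ball (PosNum e0).
  by move=> h hA s /hA /=; rewrite /ball/= distrC => /ltW.
have [N _ HN] := Ff _ nf.
by exists N => k Nk; exact: (HN k Nk).
Qed.

Lemma cvg_dist_le (R : realType) (a : nat -> R) (l : R) : a @ \oo --> l ->
  forall e : R, 0 < e -> exists N, forall k, (N <= k)%N -> `|a k - l| <= e.
Proof.
move=> /cvgrPdist_le al e e0; have [N _ HN] := al _ e0.
by exists N => k Nk; rewrite distrC; exact: HN.
Qed.

(** For [0 <= L], the retraction of the line onto [[0, L]]. Composing with it gives globally
    continuous extensions of functions controlled only on [[0, L]]. *)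
Definition clamp (R : realType) (L s : R) : R := Num.max 0 (Num.min s L).

Lemma clamp_id (R : realType) (L s : R) : s \in `[0, L] -> clamp L s = s.
Proof.
by rewrite in_itv/= => /andP[s0 sL]; rewrite /clamp (min_idPl sL) (max_idPr s0).
Qed.

Lemma clamp_itv (R : realType) (L s : R) : 0 <= L -> clamp L s \in `[0, L].
Proof.
by move=> L0; rewrite in_itv/= /clamp le_max lexx/= ge_max L0 ge_min lexx orbT.
Qed.

Lemma dist_min_le (R : realType) (l s t : R) :
  `|Num.min s l - Num.min t l| <= `|s - t|.
Proof.
by rewrite /Num.min; case: ltP => ?; case: ltP => ?; rewrite ler_norml;
  case: (ger0P (s - t)) => ?; apply/andP; split; lra.
Qed.

Lemma dist_clamp_le (R : realType) (L s t : R) :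
  `|clamp L s - clamp L t| <= `|s - t|.
Proof.
apply: le_trans (dist_min_le L s t); rewrite /clamp.
move: (Num.min s L) (Num.min t L) => {}s {}t; rewrite /Num.max.
by case: ltP => ?; case: ltP => ?; rewrite ler_norml;
  case: (ger0P (s - t)) => ?; apply/andP; split; lra.
Qed.

Lemma lipschitz_clamp_continuous (R : realType) (L : R) (f : R -> R) :
  0 <= L ->
  (forall s t, s \in `[0, L] -> t \in `[0, L] -> `|f s - f t| <= `|s - t|) ->
  continuous (fun s => f (clamp L s)).
Proof.
move=> L0 flip s; apply/cvgrPdist_le => e e0.
apply/nbhs_ballP; exists e => //= t st.
apply: (le_trans (flip _ _ (clamp_itv _ L0) (clamp_itv _ L0))).
by apply: (le_trans (dist_clamp_le _ _ _)); exact: ltW.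
Qed.

(** On the compact part of [A] where [h >= c], the distance [|f s - x|] has a positive minimum,
    which serves as [d]. This spreads a bound on a fibre to nearby fibres. *)
Lemma compact_level_set_nbhs (R : realType) (A : set R) (f h : R -> R) (x c : R) :
  compact A -> continuous f -> continuous h ->
  (forall s, A s -> f s = x -> h s < c) ->
  exists2 d : R, 0 < d & forall s, A s -> `|f s - x| < d -> h s < c.
Proof.
move=> cA cf ch fhc; pose K := A `&` h @^-1` [set y | c <= y].
have cK : compact K.
  apply: compact_closedI => //; apply: closed_comp; last exact: closed_ge.
  by move=> s _; exact: ch.
have [K0|/set0P K0] := eqVneq K set0.
  exists 1 => // s As _; rewrite ltNge; apply/negP => hs.
  by have : K s by []; rewrite K0.
have cg : continuous (fun s => - `|f s - x|).
  move=> s; apply: cvgN; apply: cvg_norm; apply: cvgB; [exact: cf|exact: cvg_cst].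
have [s0 + s0max] := compact_EVT_max K0 cK (continuous_subspaceT cg).
rewrite inE => -[As0 cs0]; exists `|f s0 - x|.
  rewrite normr_gt0 subr_eq0; apply/eqP => fs0.
  by have := fhc _ As0 fs0; rewrite ltNge cs0.
move=> s As; apply: contraTT; rewrite -!leNgt => hs.
by have := s0max s; rewrite inE lerN2; apply; split.
Qed.

(* [X] and [U] are the inverse arc length and the unfolding of [u], extended by
   constants beyond the length [l]. *)
Record graph_parametrization (R : realType) (r l : R) (u X U : R -> R) : Prop := {
  param_len_ge0 : 0 <= l ;
  param_start : X 0 = 0 ;
  param_end : X l = r ;
  param_itv : forall s, 0 <= s -> X s \in `[0, r] ;
  param_surj : forall y, y \in `[0, r] -> exists2 s, s \in `[0, l] & X s = y ;
  param_dist : forall s t, 0 <= s -> 0 <= t -> `|X s - X t| <= `|s - t| ;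
  param_unfold : forall s, 0 <= s -> U s = u (X s) ;
  param_unfold_dist : forall s t, 0 <= s -> 0 <= t -> `|U s - U t| <= `|s - t| }.

(** Transfers the result on upper limits to lower limits, without computing the arc length of
    [- u]. *)
Lemma graph_parametrizationN (R : realType) (r l : R) (u X U : R -> R) :
  graph_parametrization r l u X U ->
  graph_parametrization r l (fun y => - u y) X (fun s => - U s).
Proof.
case=> l0 X0 Xl Xi Xs Xd Uu Ud; split=> // s; first by move=> s0; rewrite Uu.
by move=> t s0 t0; rewrite -opprD normrN; exact: Ud.
Qed.

Lemma uniform_limit_lipschitz (R : realType) (L : R) (F : nat -> R -> R) (f : R -> R) :
  (forall k s t, 0 <= s -> 0 <= t -> `|F k s - F k t| <= `|s - t|) ->
  (forall e : R, 0 < e -> exists N, forall k, (N <= k)%N ->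
    forall s, s \in `[0, L] -> `|F k s - f s| <= e) ->
  forall s t, s \in `[0, L] -> t \in `[0, L] -> `|f s - f t| <= `|s - t|.
Proof.
move=> Flip Ff s t sL tL; apply/ler_addgt0Pr => e e0.
have [N /(_ N (leqnn N)) HN] := Ff (e / 2) ltac:(lra).
have := Flip N s t; have := HN s sL; have := HN t tL.
move: sL tL; rewrite !in_itv/= => /andP[s0 _] /andP[t0 _] Ht Hs /(_ s0 t0) Hst.
have -> : f s - f t = (F N s - F N t) + (- (F N s - f s) + (F N t - f t)) by ring.
apply: (le_trans (ler_normD _ _)); apply: lerD => //.
apply: (le_trans (ler_normD _ _)); rewrite normrN.
by apply: (le_trans (lerD Hs Ht)); lra.
Qed.

Section relaxed_limits.
Variables (R : realType) (r L : R) (l : nat -> R) (u X U : nat -> R -> R).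
Variables (V xbar : R -> R).
Hypothesis r0 : 0 < r.
Hypothesis param : forall k, graph_parametrization r (l k) (u k) (X k) (U k).
Hypothesis lL : forall e : R, 0 < e ->
  exists N, forall k, (N <= k)%N -> `|l k - L| <= e.
Hypothesis UV : forall e : R, 0 < e ->
  exists N, forall k, (N <= k)%N -> forall s, s \in `[0, L] -> `|U k s - V s| <= e.
Hypothesis Xx : forall e : R, 0 < e ->
  exists N, forall k, (N <= k)%N -> forall s, s \in `[0, L] -> `|X k s - xbar s| <= e.

Let L_ge0 : 0 <= L.
Proof.
apply/ler_addgt0Pr => e e0; have [N /(_ N (leqnn N))] := lL e0.
by have := param_len_ge0 (param N); rewrite ler_norml => ? /andP[_ ?]; lra.
Qed.

Let xbar_lip := uniform_limit_lipschitz (fun k => param_dist (param k)) Xx.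
Let V_lip := uniform_limit_lipschitz (fun k => param_unfold_dist (param k)) UV.

Let L0 : 0 \in `[0, L]. Proof. by rewrite in_itv/= lexx. Qed.
Let LL : L \in `[0, L]. Proof. by rewrite in_itv/= lexx andbT. Qed.

Let xbar0 : xbar 0 = 0.
Proof.
apply/eqP; rewrite -normr_le0; apply/ler_addgt0Pr => e e0; rewrite add0r.
have [N /(_ N (leqnn N) _ L0)] := Xx e0.
by rewrite (param_start (param N)) sub0r normrN.
Qed.

(** [X k] reaches [r] at [l k] rather than at [L]; the Lipschitz bound absorbs the gap
    [|l k - L|]. *)
Let xbarL : xbar L = r.
Proof.
apply/eqP; rewrite -subr_eq0 -normr_le0; apply/ler_addgt0Pr => e e0; rewrite add0r.
have e20 : 0 < e / 2 by lra.
have [N HN] := Xx e20; have [N' HN'] := lL e20.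
have := HN _ (leq_maxl N N') _ LL; have := HN' _ (leq_maxr N N').
have p := param (maxn N N').
have := param_dist p (param_len_ge0 p) L_ge0; rewrite (param_end p).
move: (X _ _) (l _) => X' l' h1 h2 h3.
have -> : xbar L - r = - (X' - xbar L) + - (r - X') by ring.
apply: (le_trans (ler_normD _ _)); rewrite !normrN.
by apply: (le_trans (lerD h3 (le_trans h1 h2))); lra.
Qed.

(** Convergence is stated, not just the value of the limit, so that it can be negated to treat the
    lower limit. *)
Lemma relaxed_limsup_param (x : R) : x \in `[0, r] -> exists M : R,
  is_max [set V s | s in [set s | s \in `[0, L] /\ xbar s = x]] M /\
  (fun j : nat => ereal_sup [set z : \bar R | exists k y,
    [/\ (j <= k)%N, y \in `[0, r], `|y - x| < j.+1%:R^-1 & z = (u k y)%:E]])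
    @ \oo --> M%:E.
Proof.
move=> xr.
have cxc := lipschitz_clamp_continuous L_ge0 xbar_lip.
have cVc := lipschitz_clamp_continuous L_ge0 V_lip.
have cJ : compact [set` `[0, L]] by exact: segment_compact.
have cxE s : s \in `[0, L] -> xbar (clamp L s) = xbar s by move=> sL; rewrite clamp_id.
have cVE s : s \in `[0, L] -> V (clamp L s) = V s by move=> sL; rewrite clamp_id.
pose K := [set` `[0, L]] `&` (fun s => xbar (clamp L s)) @^-1` [set x].
have cK : compact K.
  apply: compact_closedI => //; apply: closed_comp; last exact: closed_eq.
  by move=> s _; exact: cxc.
(* The fibre is nonempty by the intermediate value theorem, since [xbar] runs from 0 to [r]. *)
have K0 : K !=set0.
  have [c cL cx] : exists2 c, c \in `[0, L] & xbar (clamp L c) = x.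
    apply: IVT => //; first exact: continuous_subspaceT.
    rewrite !cxE// xbar0 xbarL (min_idPl (ltW r0)) (max_idPr (ltW r0)).
    by move: xr; rewrite in_itv.
  by exists c.
have [sM] := compact_EVT_max K0 cK (continuous_subspaceT cVc).
rewrite inE => -[/= sML]; rewrite cxE// => sMx; rewrite cVE// => sMmax.
have {}sMmax s : s \in `[0, L] -> xbar s = x -> V s <= V sM.
  move=> sL sx; rewrite -(cVE s sL); apply: sMmax.
  by rewrite inE; split => //=; rewrite cxE.
exists (V sM); split.
  by split; [exists sM|move=> _ [s [sL sx] <-]; exact: sMmax].
set S := fun j : nat => _.
have S_noninc : {homo S : n m / (n <= m)%N >-> (m <= n)%E}.
  move=> n m nm; apply: ereal_sup_le => _ [k [y [mk yr yx ->]]].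
  exists k, y; split => //; first exact: leq_trans mk.
  by apply: (lt_le_trans yx); rewrite lef_pV2 ?posrE// ler_nat.
(* The suprema decrease with [j], so their limit is their infimum. The lower bound comes from the
   points [X k sM], the upper one from compactness. *)
suff -> : (V sM)%:E = ereal_inf (range S) by exact: ereal_nonincreasing_cvgn.
apply/eqP; rewrite eq_le; apply/andP; split.
  apply: le_ereal_inf_tmp => _ [j _ <-]; apply/lee_addgt0Pr => e e0.
  (* Uniform convergence yields a weak inequality while the neighbourhood of radius [1/(j+1)] is
     open; the radius [1/(j+2)] restores strictness. *)
  pose d : R := j.+2%:R^-1.
  have d0 : 0 < d by rewrite invr_gt0.
  have [N1 H1] := UV e0; have [N2 H2] := Xx d0.
  pose k := maxn j (maxn N1 N2).
  have {}H1 := H1 k (leq_trans (leq_maxl _ _) (leq_maxr _ _)) sM sML.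
  have {}H2 := H2 k (leq_trans (leq_maxr _ _) (leq_maxr _ _)) sM sML.
  have sM0 : 0 <= sM by move: sML; rewrite in_itv/= => /andP[].
  apply: (@le_trans _ _ ((U k sM)%:E + e%:E)%E).
    by rewrite -EFinD lee_fin; move: H1; rewrite ler_norml => /andP[? ?]; lra.
  rewrite leeD2r//; apply: ereal_sup_ubound.
  exists k, (X k sM); split; first exact: leq_maxl.
  - exact: param_itv (param k) _ sM0.
  - by rewrite -sMx (le_lt_trans H2)// /d ltf_pV2 ?posrE// ltr_nat ltnS.
  - by rewrite -(param_unfold (param k) sM0).
apply/lee_addgt0Pr => e e0.
have [d d0 Hd] : exists2 d : R, 0 < d & forall s, s \in `[0, L] ->
    `|xbar s - x| < d -> V s < V sM + e / 2.
  have [d d0 Hd] : exists2 d : R, 0 < d & forall s, [set` `[0, L]] s ->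
      `|xbar (clamp L s) - x| < d -> V (clamp L s) < V sM + e / 2.
    apply: compact_level_set_nbhs => // s sL; rewrite cxE// cVE// => sx.
    by rewrite (le_lt_trans (sMmax s sL sx))// ltrDl; lra.
  by exists d => // s sL; have := Hd s sL; rewrite cxE// cVE.
(* Three errors of size [h] separate [xbar t] from [x] and must stay below [d]; two separate [U k s]
   from [V t] and must fit in [e / 2]. *)
pose h := Num.min (d / 4) (e / 4).
have h0 : 0 < h by rewrite /h lt_min; apply/andP; split; lra.
have hd : h <= d / 4 by rewrite /h ge_min lexx.
have he : h <= e / 4 by rewrite /h ge_min lexx orbT.
have [N1 H1] := UV h0; have [N2 H2] := Xx h0; have [N3 H3] := lL h0.
have [N4 _ H4] := near_infty_natSinv_lt (PosNum h0).
pose j := maxn (maxn N1 N2) (maxn N3 N4).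
apply: (@le_trans _ _ (S j)); first by apply: ereal_inf_lbound; exists j.
apply: ge_ereal_sup => _ [k [y [jk yr yx ->]]]; rewrite -EFinD lee_fin.
have [s sl Xs] := param_surj (param k) yr.
have {}H1 := H1 k (leq_trans (leq_trans (leq_maxl _ _) (leq_maxl _ _)) jk).
have {}H2 := H2 k (leq_trans (leq_trans (leq_maxr _ _) (leq_maxl _ _)) jk).
have {}H3 := H3 k (leq_trans (leq_trans (leq_maxl _ _) (leq_maxr _ _)) jk).
have {}H4 := H4 j (leq_trans (leq_maxr _ _) (leq_maxr _ _)).
have /= {}yx := lt_trans yx H4.
have s0 : 0 <= s by move: sl; rewrite in_itv/= => /andP[].
(* The part of the graph beyond length [L] is short, so [s] may be replaced by
   its truncation [t], where uniform convergence applies. *)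
pose t := Num.min s L.
have t0 : 0 <= t by rewrite /t le_min s0.
have tL : t \in `[0, L] by rewrite in_itv/= t0 /t ge_min lexx orbT.
have st : `|s - t| <= h.
  apply: le_trans H3; rewrite /t; case: (leP s L) => sL; first by rewrite subrr normr0.
  move: sl; rewrite in_itv/= => /andP[_ sl].
  by rewrite !gtr0_norm ?subr_gt0// ?lerB// (lt_le_trans sL).
have dX := le_trans (param_dist (param k) s0 t0) st.
have dU := le_trans (param_unfold_dist (param k) s0 t0) st.
have {}H1 := H1 t tL; have {}H2 := H2 t tL.
rewrite -Xs -(param_unfold (param k) s0).
have Vt : V t < V sM + e / 2.
  apply: Hd => //; rewrite Xs in dX.
  have -> : xbar t - x = - (X k t - xbar t) + (- (y - X k t) + (y - x)) by ring.
  apply: (le_lt_trans (ler_normD _ _)); rewrite normrN.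
  apply: (@le_lt_trans _ _ (h + (h + h))); last by lra.
  rewrite lerD//; apply: (le_trans (ler_normD _ _)); rewrite normrN.
  by rewrite lerD// ltW.
move: dU H1; rewrite !ler_norml => /andP[_ dU] /andP[_ H1].
by lra.
Qed.
End relaxed_limits.

(** * Unfoldings *)

(** [W11] provides a witness, so [xget] does not fall back on its default 0. *)
Lemma weak_derivativeP (R : realType) (r : R) (u : R -> R) :
  W11 r u -> is_weak_derivative r u (weak_derivative r u).
Proof. by case=> _ _ [g wg]; exact: (xgetPex (fun=> 0) (ex_intro _ g wg)). Qed.

Section unfolding.
Variables (R : realType) (r : R) (u : R -> R).
Hypothesis r0 : 0 < r.
Hypothesis uW : W11 r u.
Let cu : {within `[0, r], continuous u}. Proof. by case: uW. Qed.
Let wu : is_weak_derivative r u (weak_derivative r u).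
Proof. exact: weak_derivativeP. Qed.
Let ig := wu.1.

Local Notation s := (arc_length_param r u).
Local Notation l := (graph_length r u).
Local Notation X := (arc_length_inverse r u).

Let s0 : s 0 = 0.
Proof. by rewrite /arc_length_param set_itvoo0 Rintegral_set0. Qed.

Let s_incr (x y : R) : 0 <= x -> x <= y -> y <= r -> y - x <= s y - s x.
Proof. by move=> x0 xy yr; apply (arc_length_increment_ge ig). Qed.

Let u_incr (x y : R) : 0 <= x -> x <= y -> y <= r -> `|u y - u x| <= s y - s x.
Proof. by move=> x0 xy yr; apply (W11_increment_le cu wu). Qed.

Let s_homo (x y : R) : 0 <= x -> x <= y -> y <= r -> s x <= s y.
Proof. by move=> x0 xy yr; have := s_incr x0 xy yr; lra. Qed.

Let s_itv (y : R) : y \in `[0, r] -> s y \in `[0, l].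
Proof.
rewrite !in_itv/= => /andP[y0 yr].
by rewrite -{1}s0 s_homo//= /graph_length s_homo.
Qed.

Let s_surj (t : R) : t \in `[0, l] -> exists2 x, x \in `[0, r] & s x = t.
Proof.
rewrite in_itv/= => tl; apply: IVT; [exact: ltW|exact: arc_length_continuous|].
have sr : s 0 <= s r by apply: s_homo => //; exact: ltW.
by rewrite (min_idPl sr) (max_idPr sr) s0.
Qed.

Let s_inj : {in [set` `[0, r]] &, injective s}.
Proof.
have s_lt x y : 0 <= x -> x < y -> y <= r -> s x < s y.
  by move=> x0 xy yr; have := s_incr x0 (ltW xy) yr; lra.
move=> x y; rewrite !inE/= !in_itv/= => /andP[x0 xr] /andP[y0 yr] sxy.
have [xy|xy|//] := ltgtP x y.
  by have := s_lt _ _ x0 xy yr; rewrite sxy ltxx.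
by have := s_lt _ _ y0 xy xr; rewrite sxy ltxx.
Qed.

Let sK (x : R) : x \in `[0, r] -> X (s x) = x.
Proof. by move=> xr; apply: pinvKV s_inj _ _; rewrite inE. Qed.

Let X_itv (t : R) : t \in `[0, l] -> X t \in `[0, r].
Proof. by move=> /s_surj[x xr <-]; rewrite sK. Qed.

(** For [t = s x] and [t' = s y] these are [s_incr] and [u_incr] read through the inverse. *)
Let X_dist (t t' : R) : t \in `[0, l] -> t' \in `[0, l] ->
  `|X t - X t'| <= `|t - t'| /\ `|u (X t) - u (X t')| <= `|t - t'|.
Proof.
move=> /s_surj[x xr <-] /s_surj[y yr <-]; rewrite !sK//.
move: xr yr; rewrite !in_itv/= => /andP[x0 xr] /andP[y0 yr].
wlog xy : x y x0 xr y0 yr / x <= y.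
  move=> H; have [xy|/ltW yx] := leP x y; first exact: H.
  by rewrite (distrC x) (distrC (u x)) (distrC (s x)); exact: H.
rewrite (distrC x) (distrC (u x)) (distrC (s x)).
rewrite ger0_norm ?subr_ge0// ger0_norm ?subr_ge0//; last exact: s_homo.
by split; [exact: s_incr|exact: u_incr].
Qed.

(** Truncation at [l] is 1-Lipschitz and sends nonnegative parameters into [[0, l]], so the
    extensions inherit the bounds of [X_dist]. *)
Lemma unfolding_parametrization : graph_parametrization r l u
  (extend_const l X) (extend_const l (unfolding r u)).
Proof.
have l0 : 0 <= l by rewrite -s0 /graph_length; apply: s_homo => //; exact: ltW.
have min_itv t : 0 <= t -> Num.min t l \in `[0, l].
  by move=> t0; rewrite in_itv/= le_min t0 l0 ge_min lexx orbT.
have r_itv : r \in `[0, r] by rewrite in_itv/= lexx ltW.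
split=> //; rewrite /extend_const.
- by rewrite (min_idPl l0) -[in X 0]s0 sK// in_itv/= lexx ltW.
- by rewrite minxx /graph_length sK.
- by move=> t t0; apply: X_itv; exact: min_itv.
- move=> y yr; exists (s y); first exact: s_itv.
  by have := s_itv yr; rewrite in_itv/= => /andP[_ /min_idPl ->]; exact: sK.
- move=> t t' t0 t'0.
  by have [h _] := X_dist (min_itv _ t0) (min_itv _ t'0);
    apply: le_trans h (dist_min_le _ _ _).
- move=> t t' t0 t'0.
  by have [_ h] := X_dist (min_itv _ t0) (min_itv _ t'0);
    apply: le_trans h (dist_min_le _ _ _).
Qed.
End unfolding.

Theorem theorem3p1 (R : realType) (r : R) (u : nat -> R -> R)
    (L : R) (V xbar : R -> R)
    (r_gt0 : 0 < r)
    (u_W11 : forall k : nat, W11 r (u k))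
    (u_TV : (ereal_sup (range (fun k : nat => TV r (u k))) < +oo)%E)
    (cvg_length : (fun k : nat => graph_length r (u k)) @ \oo --> L)
    (cvg_unfolding :
      {uniform `[0, L],
        (fun k : nat =>
          extend_const (graph_length r (u k)) (unfolding r (u k))) @ \oo
        --> V})
    (cvg_inverse :
      {uniform `[0, L],
        (fun k : nat =>
          extend_const (graph_length r (u k)) (arc_length_inverse r (u k)))
          @ \oo
        --> xbar}) :
  forall x : R, x \in `[0, r] ->
    (exists M : R,
      is_max [set V s | s in [set s | s \in `[0, L] /\ xbar s = x]] M /\
      relaxed_limsup r u x = M%:E) /\
    (exists m : R,
      is_min [set V s | s in [set s | s \in `[0, L] /\ xbar s = x]] m /\
      relaxed_liminf r u x = m%:E).
Proof.
move=> x xr.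
have param k := unfolding_parametrization r_gt0 (u_W11 k).
have lL := cvg_dist_le cvg_length.
have UV := cvg_uniform_dist_le cvg_unfolding.
have Xx := cvg_uniform_dist_le cvg_inverse.
split.
  have [M [maxM /(cvg_lim (@ereal_hausdorff R)) cM]] :=
    relaxed_limsup_param r_gt0 param lL UV Xx xr.
  by exists M.
(* For the lower limit the upper one is applied to [- u k], with limit [- V] and the same [xbar]. *)
have UVN e (e0 : 0 < e) : exists N, forall k, (N <= k)%N -> forall s, s \in `[0, L] ->
    `|- extend_const (graph_length r (u k)) (unfolding r (u k)) s - - V s| <= e.
  have [N HN] := UV e e0; exists N => k Nk s sL.
  by rewrite -opprD normrN; exact: HN.
have [M [[[s [sL sx] VM] maxM] cM]] := relaxed_limsup_param r_gt0
  (fun k => graph_parametrizationN (param k)) lL UVN Xx xr.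
exists (- M); split.
  split; first by exists s => //; rewrite -VM opprK.
  by move=> _ [t [tL tx] <-]; rewrite lerNl; apply: maxM; exists t.
(* For each [j], the infimum of the values of [u] is minus the supremum of the values of [- u]. *)
apply: cvg_lim => //; rewrite EFinN; move/cvgeN: cM; apply: cvg_trans.
apply: near_eq_cvg; apply: nearW => j; rewrite ereal_infEN; congr (- ereal_sup _)%E.
apply/seteqP; split=> [_ [k [y [jk yr yx ->]]]|_ [_ [k [y [jk yr yx ->]]] <-]].
  by exists (u k y)%:E => //; exists k, y.
by exists k, y.
Qed.
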